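(* Let $a_1,a_2,a_3$ be pairwise distinct constants, $\phi_k=4(a_1-u_k)(a_2-u_k)(a_3-u_k)$, $k=1,2$, and consider the space with coordinates $(u_1,u_2,p_{u_1},p_{u_2})$ and canonical Poisson bracket $$\{u_i,p_{u_j}\}=\delta_{ij},\qquad \{u_1,u_2\}=\{p_{u_1},p_{u_2}\}=0.$$ Let $\hat u_1,\hat u_2$ be the roots of the quadratic polynomial $$\hat A_2x^2+\hat A_1x+4a_1a_2a_3\left(\frac{u_1\phi_1p_{u_1}^2}{u_2-u_1}+\frac{u_2\phi_2p_{u_2}^2}{u_1-u_2}\right),$$ where $$\hat A_2=\frac{\bigl(4u_1^2(u_2-u_1)-\phi_1\bigr)\phi_1p_{u_1}^2}{(u_1-u_2)^2}+\frac{2\phi_1\phi_2p_{u_1}p_{u_2}}{(u_1-u_2)^2}+\frac{\bigl(4u_2^2(u_1-u_2)-\phi_2\bigr)\phi_2p_{u_2}^2}{(u_2-u_1)^2},$$ $$\hat A_1=\frac{\bigl(4u_1^2(a_1+a_2+a_3-u_1)-\phi_1\bigr)\phi_1p_{u_1}^2}{u_1-u_2}+\frac{\bigl(4u_2^2(a_1+a_2+a_3-u_2)-\phi_2\bigr)\phi_2p_{u_2}^2}{u_2-u_1},$$ and let $$\hat p_{u_k}=-\frac{1}{4(a_1-\hat u_k)(a_2-\hat u_k)(a_3-\hat u_k)}\left(\frac{(\hat u_k-u_2)\phi_1p_{u_1}}{u_1-u_2}+\frac{(\hat u_k-u_1)\phi_2p_{u_2}}{u_2-u_1}\right),\qquad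 k=1,2.$$ Then the canonical Poisson bracket has the same form in the variables $\hat u_{1,2}$, $\hat p_{u_{1,2}}$: $$\{\hat u_i,\hat p_{u_j}\}=\delta_{ij},\qquad \{\hat u_1,\hat u_2\}=\{\hat p_{u_1},\hat p_{u_2}\}=0.$$
   Context: The statement is local and generic: it is considered on an open set where all denominators are nonzero ($u_1\ne u_2$, $\hat A_2\neq0$, $\hat u_1\ne\hat u_2$, $\hat u_k\notin\{0,a_1,a_2,a_3\}$), with a smooth labelling of the two roots. *)

(* Defs.v *)
(* MathComp-Analysis *)
From HB Require Import structures.
From mathcomp Require Export all_boot all_order all_algebra.
From mathcomp Require Export all_classical all_reals all_analysis.
Export Order.TTheory GRing.Theory Num.Theory.
Export numFieldNormedType.Exports.

Set Implicit Arguments.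
Unset Strict Implicit.
Unset Printing Implicit Defensive.

Local Open Scope classical_set_scope.
Local Open Scope ring_scope.

(* A point x has position coordinates (u_1, u_2) = x.1 and momenta
   (p_{u_1}, p_{u_2}) = x.2; the indices 1, 2 are 0, 1 : 'I_2.  The scalars
   form any numFieldType, e.g. a real field or its complexification. *)
Definition phase (K : numFieldType) : normedModType K :=
  ('rV[K]_2 * 'rV[K]_2)%type.

Definition u1 (K : numFieldType) (x : phase K) : K := x.1 0 0.
Definition u2 (K : numFieldType) (x : phase K) : K := x.1 0 1.
Definition p1 (K : numFieldType) (x : phase K) : K := x.2 0 0.
Definition p2 (K : numFieldType) (x : phase K) : K := x.2 0 1.

Definition d_u (K : numFieldType) (i : 'I_2) (f : phase K -> K) (x : phase K)
  : K := 'D_((delta_mx 0 i, 0) : phase K) f x.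
Definition d_p (K : numFieldType) (i : 'I_2) (f : phase K -> K) (x : phase K)
  : K := 'D_((0, delta_mx 0 i) : phase K) f x.

(* The biderivation with {u_i, p_j} = delta_ij, {u_1, u_2} = {p_1, p_2} = 0. *)
Definition bracket (K : numFieldType) (f g : phase K -> K) (x : phase K) : K :=
  \sum_(i < 2) (d_u i f x * d_p i g x - d_p i f x * d_u i g x).

(* C^infinity on an open set U: every iterated directional derivative is
   (Frechet) differentiable at every point of U. *)
Definition smooth_on (K : numFieldType) (U : set (phase K)) (f : phase K -> K)
  : Prop :=
  forall (s : seq (phase K)) (x : phase K), U x ->
    differentiable (foldr (fun v g => fun y => 'D_v g y) f s) x.

Definition phi (K : numFieldType) (a1 a2 a3 u : K) : K :=
  4 * (a1 - u) * (a2 - u) * (a3 - u).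

Definition A2hat (K : numFieldType) (a1 a2 a3 : K) (x : phase K) : K :=
  let f1 := phi a1 a2 a3 (u1 x) in
  let f2 := phi a1 a2 a3 (u2 x) in
  (4 * u1 x ^+ 2 * (u2 x - u1 x) - f1) * f1 * p1 x ^+ 2 / (u1 x - u2 x) ^+ 2
  + 2 * f1 * f2 * p1 x * p2 x / (u1 x - u2 x) ^+ 2
  + (4 * u2 x ^+ 2 * (u1 x - u2 x) - f2) * f2 * p2 x ^+ 2
    / (u2 x - u1 x) ^+ 2.

Definition A1hat (K : numFieldType) (a1 a2 a3 : K) (x : phase K) : K :=
  let f1 := phi a1 a2 a3 (u1 x) in
  let f2 := phi a1 a2 a3 (u2 x) in
  (4 * u1 x ^+ 2 * (a1 + a2 + a3 - u1 x) - f1) * f1 * p1 x ^+ 2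
    / (u1 x - u2 x)
  + (4 * u2 x ^+ 2 * (a1 + a2 + a3 - u2 x) - f2) * f2 * p2 x ^+ 2
    / (u2 x - u1 x).

Definition A0hat (K : numFieldType) (a1 a2 a3 : K) (x : phase K) : K :=
  let f1 := phi a1 a2 a3 (u1 x) in
  let f2 := phi a1 a2 a3 (u2 x) in
  4 * a1 * a2 * a3 *
  (u1 x * f1 * p1 x ^+ 2 / (u2 x - u1 x)
   + u2 x * f2 * p2 x ^+ 2 / (u1 x - u2 x)).

Definition hat_poly (K : numFieldType) (a1 a2 a3 : K) (x : phase K)
  : {poly K} :=
  A2hat a1 a2 a3 x *: 'X^2 + A1hat a1 a2 a3 x *: 'X + (A0hat a1 a2 a3 x)%:P.

(* The momentum paired with the root v : phase K -> K of hat_poly. *)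
Definition phat (K : numFieldType) (a1 a2 a3 : K) (v : phase K -> K)
  (x : phase K) : K :=
  - (1 / (4 * (a1 - v x) * (a2 - v x) * (a3 - v x)))
  * ((v x - u2 x) * phi a1 a2 a3 (u1 x) * p1 x / (u1 x - u2 x)
     + (v x - u1 x) * phi a1 a2 a3 (u2 x) * p2 x / (u2 x - u1 x)).

(* Main.v *)
(* Let V and H be the affine functions of z with V(u_k) = phi(u_k) p_k and
   H(u_k) = u_k^2 phi(u_k) p_k^2, and let A be the quadratic polynomial with
   roots uhat_k.  Then
     z^2 V(z)^2 - phi(z) H(z) = - (z - u_1) (z - u_2) A(z)
   and phat_k = - V(uhat_k) / phi(uhat_k).  Differentiating A(uhat_k) = 0 gives
     dphat_k ^ duhat_k = (dV ^ dA)(uhat_k) / (phi(uhat_k) A'(uhat_k)),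
   while differentiating the factorization (for fixed z) gives, modulo A(z),
     (dV ^ dA)(z) = phi(z) (A_2 omega z + S_0),
   where omega = dp_1 ^ du_1 + dp_2 ^ du_2, A_2 is the leading coefficient of A
   and S_0 does not depend on z.  By Lagrange interpolation at the two roots,
   the sum over k of (A_2 omega uhat_k + S_0) / A'(uhat_k) is omega, so the
   canonical 2-form, hence also the Poisson bracket, is preserved. *)
Require Import Defs.
From mathcomp Require Import ring.

Local Open Scope classical_set_scope.
Local Open Scope ring_scope.

(** * Directional derivatives of scalar functions *)

Section LinearDerive.
Set Implicit Arguments.
Unset Strict Implicit.
Variables (K : numFieldType) (V : normedModType K).

Lemma is_derive_linear (f : V -> K) (x v : V) :
  (forall h, f (h *: v + x) = h * f v + f x) -> is_derive x v f (f v).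
Proof.
move=> fE.
have cvf : h^-1 *: ((f \o shift x) (h *: v) - f x) @[h --> (0 : K)^'] --> f v.
  apply: cvg_near_cst; near=> h; rewrite /= fE addrK.
  have h0 : h != 0 by near: h; exact: nbhs_dnbhs_neq.
  by rewrite -[LHS]/(h^-1 * (h * f v)) mulKf.
by apply: DeriveDef; [apply: cvgP cvf | exact: cvg_lim cvf].
Unshelve. all: by end_near. Qed.

Lemma is_derive_mul (f g : V -> K) (x v : V) (df dg : K) :
  is_derive x v f df -> is_derive x v g dg ->
  is_derive x v (fun y => f y * g y) (df * g x + f x * dg).
Proof.
move=> ? ?; apply: (is_derive_eq (is_deriveM _ _)).
by rewrite addrC [df * _]mulrC.
Qed.

Lemma is_derive_inv (f : V -> K) (x v : V) (df : K) :
  f x != 0 -> is_derive x v f df ->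
  is_derive x v (fun y => (f y)^-1) (- df / f x ^+ 2).
Proof.
move=> fx0 [fdrv <-]; apply: DeriveDef; first exact: derivableV.
by rewrite deriveV// mulNr scaleNr mulrC.
Qed.

End LinearDerive.

(** The hypotheses amount to an explicit left inverse of the Jacobian with blocks [Qu], [Qp], [Pu],
    [Pp]. For square matrices it is also a right inverse, and the blocks of that second product are
    the conclusions. This is the passage from the canonical 2-form to the Poisson bracket. *)
Lemma symplectic_trmx (R : comNzRingType) n (Qu Qp Pu Pp : 'M[R]_n) :
  Pu^T *m Qu - Qu^T *m Pu = 0 -> Pp^T *m Qp - Qp^T *m Pp = 0 ->
  Pp^T *m Qu - Qp^T *m Pu = 1%:M ->
  [/\ Qu *m Pp^T - Qp *m Pu^T = 1%:M, Qu *m Qp^T - Qp *m Qu^T = 0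
    & Pu *m Pp^T - Pp *m Pu^T = 0].
Proof.
move=> uu pp pu.
have up : - Pu^T *m Qp + Qu^T *m Pp = 1%:M.
  by rewrite mulNmx addrC -[RHS]trmx1 -pu linearB /= !trmx_mul !trmxK.
have : block_mx Pp^T (- Qp^T) (- Pu^T) Qu^T *m block_mx Qu Qp Pu Pp = 1%:M.
  rewrite mulmx_block up !mulNmx pu pp.
  by rewrite -[- _ + _]opprK opprD opprK uu oppr0 -scalar_mx_block.
move=> /mulmx1C; rewrite mulmx_block !mulmxN scalar_mx_block.
move=> /eq_block_mx[QP /eqP QQ PP _]; split=> //.
by apply/eqP; rewrite -oppr_eq0 opprB addrC.
Qed.

(** * Coordinates and affine interpolation at u_1, u_2 *)

Section Canonical.
Set Implicit Arguments.
Unset Strict Implicit.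
Variables (K : numFieldType) (a1 a2 a3 : K).
Implicit Types x y v w : phase K.

Lemma is_derive_u1 x v : is_derive x v (@u1 K) (u1 v).
Proof. by apply: is_derive_linear => h; rewrite /u1 !mxE. Qed.

Lemma is_derive_u2 x v : is_derive x v (@u2 K) (u2 v).
Proof. by apply: is_derive_linear => h; rewrite /u2 !mxE. Qed.

Lemma is_derive_p1 x v : is_derive x v (@p1 K) (p1 v).
Proof. by apply: is_derive_linear => h; rewrite /p1 !mxE. Qed.

Lemma is_derive_p2 x v : is_derive x v (@p2 K) (p2 v).
Proof. by apply: is_derive_linear => h; rewrite /p2 !mxE. Qed.

Definition dphi (u : K) : K :=
  - 4 * ((a2 - u) * (a3 - u) + (a1 - u) * (a3 - u) + (a1 - u) * (a2 - u)).

Lemma is_derive_phi (f : phase K -> K) x v df : is_derive x v f df ->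
  is_derive x v (fun y => phi a1 a2 a3 (f y)) (dphi (f x) * df).
Proof.
move=> fdf.
have sub a : is_derive x v (fun y => a - f y) (0 - df).
  exact: (is_deriveB (is_derive_cst a x v)).
refine (is_derive_eq (is_derive_mul (is_derive_mul (is_derive_mul
  (is_derive_cst (4 : K) x v) (sub a1)) (sub a2)) (sub a3)) _).
by rewrite /dphi /cst; ring.
Qed.

(* The affine function [z |-> slope F G y * z + icept F G y] takes the value
   [F y] at [u1 y] and [G y] at [u2 y]. *)
Definition slope (F G : phase K -> K) y : K := (F y - G y) / (u1 y - u2 y).
Definition icept (F G : phase K -> K) y : K :=
  (u1 y * G y - u2 y * F y) / (u1 y - u2 y).
Definition dslope (F G : phase K -> K) (dF dG : phase K -> phase K -> K) y v :=
  (dF y v - dG y v) / (u1 y - u2 y)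
  - (F y - G y) * (u1 v - u2 v) / (u1 y - u2 y) ^+ 2.
Definition dicept (F G : phase K -> K) (dF dG : phase K -> phase K -> K) y v :=
  (u1 v * G y + u1 y * dG y v - u2 v * F y - u2 y * dF y v) / (u1 y - u2 y)
  - (u1 y * G y - u2 y * F y) * (u1 v - u2 v) / (u1 y - u2 y) ^+ 2.

Section Interpolation.
Variables (F G : phase K -> K) (dF dG : phase K -> phase K -> K).
Variables x v : phase K.
Hypotheses (xu : u1 x - u2 x != 0).
Hypotheses (hF : is_derive x v F (dF x v)) (hG : is_derive x v G (dG x v)).

Let is_derive_u12V : is_derive x v (fun y => (u1 y - u2 y)^-1)
  (- (u1 v - u2 v) / (u1 x - u2 x) ^+ 2).
Proof.
apply: (is_derive_inv (f := fun y => u1 y - u2 y)) => //.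
exact: (is_deriveB (is_derive_u1 x v) (is_derive_u2 x v)).
Qed.

Lemma is_derive_slope : is_derive x v (slope F G) (dslope F G dF dG x v).
Proof.
refine (is_derive_eq (is_derive_mul (is_deriveB hF hG) is_derive_u12V) _).
by rewrite /dslope !fctE; field.
Qed.

Lemma is_derive_icept : is_derive x v (icept F G) (dicept F G dF dG x v).
Proof.
refine (is_derive_eq (is_derive_mul
  (is_deriveB (is_derive_mul (is_derive_u1 x v) hG)
              (is_derive_mul (is_derive_u2 x v) hF)) is_derive_u12V) _).
by rewrite /dicept !fctE; field.
Qed.

End Interpolation.

(** * The affine functions V and H and their differentials *)

Definition val1 y : K := phi a1 a2 a3 (u1 y) * p1 y.
Definition val2 y : K := phi a1 a2 a3 (u2 y) * p2 y.
Definition dval1 y v : K :=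
  dphi (u1 y) * u1 v * p1 y + phi a1 a2 a3 (u1 y) * p1 v.
Definition dval2 y v : K :=
  dphi (u2 y) * u2 v * p2 y + phi a1 a2 a3 (u2 y) * p2 v.

Definition ham1 y : K := u1 y ^+ 2 * phi a1 a2 a3 (u1 y) * p1 y ^+ 2.
Definition ham2 y : K := u2 y ^+ 2 * phi a1 a2 a3 (u2 y) * p2 y ^+ 2.
Definition dham1 y v : K :=
  (2 * u1 y * u1 v * phi a1 a2 a3 (u1 y)
   + u1 y ^+ 2 * (dphi (u1 y) * u1 v)) * p1 y ^+ 2
  + u1 y ^+ 2 * phi a1 a2 a3 (u1 y) * (2 * p1 y * p1 v).
Definition dham2 y v : K :=
  (2 * u2 y * u2 v * phi a1 a2 a3 (u2 y)
   + u2 y ^+ 2 * (dphi (u2 y) * u2 v)) * p2 y ^+ 2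
  + u2 y ^+ 2 * phi a1 a2 a3 (u2 y) * (2 * p2 y * p2 v).

Lemma is_derive_val1 x v : is_derive x v val1 (dval1 x v).
Proof.
exact: is_derive_mul (is_derive_phi (is_derive_u1 x v)) (is_derive_p1 x v).
Qed.

Lemma is_derive_val2 x v : is_derive x v val2 (dval2 x v).
Proof.
exact: is_derive_mul (is_derive_phi (is_derive_u2 x v)) (is_derive_p2 x v).
Qed.

Lemma is_derive_sqr (f : phase K -> K) x v df : is_derive x v f df ->
  is_derive x v (fun y => f y ^+ 2) (2 * f x * df).
Proof.
by move=> fdf; refine (is_derive_eq (is_derive_mul fdf fdf) _); ring.
Qed.

Lemma is_derive_ham1 x v : is_derive x v ham1 (dham1 x v).
Proof.
have [u p] := (is_derive_u1 x v, is_derive_p1 x v).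
exact: is_derive_mul (is_derive_mul (is_derive_sqr u) (is_derive_phi u))
  (is_derive_sqr p).
Qed.

Lemma is_derive_ham2 x v : is_derive x v ham2 (dham2 x v).
Proof.
have [u p] := (is_derive_u2 x v, is_derive_p2 x v).
exact: is_derive_mul (is_derive_mul (is_derive_sqr u) (is_derive_phi u))
  (is_derive_sqr p).
Qed.

Definition V1 := slope val1 val2.
Definition V0 := icept val1 val2.
Definition H1 := slope ham1 ham2.
Definition H0 := icept ham1 ham2.
Definition dV1 := dslope val1 val2 dval1 dval2.
Definition dV0 := dicept val1 val2 dval1 dval2.
Definition dH1 := dslope ham1 ham2 dham1 dham2.
Definition dH0 := dicept ham1 ham2 dham1 dham2.

Lemma is_derive_VH x v : u1 x - u2 x != 0 ->
  [/\ is_derive x v V1 (dV1 x v), is_derive x v V0 (dV0 x v),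
      is_derive x v H1 (dH1 x v) & is_derive x v H0 (dH0 x v)].
Proof.
move=> xu; have [dv1 dv2] := (is_derive_val1 x v, is_derive_val2 x v).
have [dh1 dh2] := (is_derive_ham1 x v, is_derive_ham2 x v).
by split; [exact: is_derive_slope | exact: is_derive_icept
          | exact: is_derive_slope | exact: is_derive_icept].
Qed.

(** * The coefficients of A in terms of V and H *)

Let s1 : K := a1 + a2 + a3.
Let s2 : K := a1 * a2 + a1 * a3 + a2 * a3.

(** This formula and the next two compare the coefficients of z^4, z^3 and z^2 in the factorization
    z^2 V^2 - phi H = - (z - u_1) (z - u_2) A; [s1] and [s2] enter through the expansion of phi. *)
Lemma A2hatE y : u1 y - u2 y != 0 ->
  A2hat a1 a2 a3 y = - V1 y ^+ 2 - 4 * H1 y.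
Proof.
move=> yu; rewrite /A2hat /V1 /H1 /slope /val1 /val2 /ham1 /ham2.
have yu' : u2 y - u1 y != 0 by rewrite -opprB oppr_eq0.
by field; rewrite yu yu'.
Qed.

Lemma A1hatE y : u1 y - u2 y != 0 ->
  A1hat a1 a2 a3 y = (u1 y + u2 y) * (- V1 y ^+ 2 - 4 * H1 y)
    - 2 * V1 y * V0 y - 4 * H0 y + 4 * s1 * H1 y.
Proof.
move=> yu; have yu' : u2 y - u1 y != 0 by rewrite -opprB oppr_eq0.
rewrite /A1hat /V1 /H1 /V0 /H0 /slope /icept /val1 /val2 /ham1 /ham2 /s1.
by field; rewrite yu yu'.
Qed.

Lemma A0hatE y : u1 y - u2 y != 0 ->
  A0hat a1 a2 a3 y = - (V0 y ^+ 2 - 4 * s1 * H0 y + 4 * s2 * H1 y)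
    + (u1 y + u2 y) * ((u1 y + u2 y) * (- V1 y ^+ 2 - 4 * H1 y)
      - 2 * V1 y * V0 y - 4 * H0 y + 4 * s1 * H1 y)
    - u1 y * u2 y * (- V1 y ^+ 2 - 4 * H1 y).
Proof.
move=> yu; have yu' : u2 y - u1 y != 0 by rewrite -opprB oppr_eq0.
rewrite /A0hat /V1 /H1 /V0 /H0 /slope /icept /val1 /val2 /ham1 /ham2 /s1 /s2.
by rewrite /phi; field; rewrite yu yu'.
Qed.

Lemma root_hat_poly y z : root (hat_poly a1 a2 a3 y) z ->
  A2hat a1 a2 a3 y * z ^+ 2 + A1hat a1 a2 a3 y * z + A0hat a1 a2 a3 y = 0.
Proof.
by move=> /rootP; rewrite /hat_poly !hornerD !hornerZ hornerXn hornerX hornerC.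
Qed.

Definition dA2 x v : K := - (2 * V1 x * dV1 x v) - 4 * dH1 x v.
Definition dA1 x v : K :=
  (u1 v + u2 v) * (- V1 x ^+ 2 - 4 * H1 x) + (u1 x + u2 x) * dA2 x v
  - 2 * (dV1 x v * V0 x + V1 x * dV0 x v) - 4 * dH0 x v + 4 * s1 * dH1 x v.
Definition dA0 x v : K :=
  - (2 * V0 x * dV0 x v - 4 * s1 * dH0 x v + 4 * s2 * dH1 x v)
  + (u1 v + u2 v) * ((u1 x + u2 x) * (- V1 x ^+ 2 - 4 * H1 x)
      - 2 * V1 x * V0 x - 4 * H0 x + 4 * s1 * H1 x)
  + (u1 x + u2 x) * dA1 x v
  - (u1 v * u2 x + u1 x * u2 v) * (- V1 x ^+ 2 - 4 * H1 x)
  - u1 x * u2 x * dA2 x v.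

(** * Differentials of the coefficients, of a root and of its momentum *)

Section HatPolynomial.
Variables x v : phase K.
Hypothesis xu : \forall y \near x, u1 y - u2 y != 0.

(** The formula in V and H is available where u_1 and u_2 differ, hence near [x], which suffices to
    transfer its derivative. *)
Lemma is_derive_A2hat : is_derive x v (A2hat a1 a2 a3) (dA2 x v).
Proof.
apply: (near_eq_is_derive (f := fun y => - V1 y ^+ 2 - 4 * H1 y)).
  near=> y => /=; have yu : u1 y - u2 y != 0 by near: y.
  by rewrite A2hatE.
have [d1 d0 e1 e0] := is_derive_VH v (nbhs_singleton xu).
refine (is_derive_eq (is_deriveB (is_deriveN (is_derive_sqr d1))
  (is_derive_mul (is_derive_cst (4 : K) x v) e1)) _).
by rewrite /dA2 /cst; ring.
Unshelve. all: by end_near. Qed.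

Lemma is_derive_A1hat : is_derive x v (A1hat a1 a2 a3) (dA1 x v).
Proof.
apply: (near_eq_is_derive (f := fun y =>
    (u1 y + u2 y) * A2hat a1 a2 a3 y
    - 2 * V1 y * V0 y - 4 * H0 y + 4 * s1 * H1 y)).
  near=> y => /=; have yu : u1 y - u2 y != 0 by near: y.
  by rewrite A1hatE// A2hatE.
have xu0 := nbhs_singleton xu; have [d1 d0 e1 e0] := is_derive_VH v xu0.
have c (c0 : K) : is_derive x v (fun=> c0) 0.
  exact: (is_derive_cst c0 x v).
have s := is_deriveD (is_derive_u1 x v) (is_derive_u2 x v).
refine (is_derive_eq (is_deriveD (is_deriveB (is_deriveB
  (is_derive_mul s is_derive_A2hat)
  (is_derive_mul (is_derive_mul (c 2) d1) d0)) (is_derive_mul (c 4) e0))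
  (is_derive_mul (c (4 * s1)) e1)) _).
by rewrite /dA1 !fctE A2hatE//; ring.
Unshelve. all: by end_near. Qed.

Lemma is_derive_A0hat : is_derive x v (A0hat a1 a2 a3) (dA0 x v).
Proof.
apply: (near_eq_is_derive (f := fun y =>
    - (V0 y ^+ 2 - 4 * s1 * H0 y + 4 * s2 * H1 y)
    + (u1 y + u2 y) * A1hat a1 a2 a3 y - u1 y * u2 y * A2hat a1 a2 a3 y)).
  near=> y => /=; have yu : u1 y - u2 y != 0 by near: y.
  by rewrite A0hatE// A1hatE// A2hatE.
have xu0 := nbhs_singleton xu; have [d1 d0 e1 e0] := is_derive_VH v xu0.
have c (c0 : K) : is_derive x v (fun=> c0) 0.
  exact: (is_derive_cst c0 x v).
have [d_u1 d_u2] := (is_derive_u1 x v, is_derive_u2 x v).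
refine (is_derive_eq (is_deriveB (is_deriveD
  (is_deriveN (is_deriveD (is_deriveB (is_derive_sqr d0)
    (is_derive_mul (c (4 * s1)) e0)) (is_derive_mul (c (4 * s2)) e1)))
  (is_derive_mul (is_deriveD d_u1 d_u2) is_derive_A1hat))
  (is_derive_mul (is_derive_mul d_u1 d_u2) is_derive_A2hat)) _).
by rewrite /dA0 !fctE A2hatE// A1hatE//; ring.
Unshelve. all: by end_near. Qed.

Variables (f : phase K -> K) (df : K).
Hypothesis fdf : is_derive x v f df.

(** The value of A at [f] vanishes near [x], so its derivative, expanded by the product rule, is
    that of the constant 0. *)
Lemma is_derive_root :
  (\forall y \near x, root (hat_poly a1 a2 a3 y) (f y)) ->
  (dA2 x v * f x ^+ 2 + dA1 x v * f x + dA0 x v)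
  + (2 * A2hat a1 a2 a3 x * f x + A1hat a1 a2 a3 x) * df = 0.
Proof.
move=> rootf.
have h := is_deriveD (is_deriveD
  (is_derive_mul is_derive_A2hat (is_derive_sqr fdf))
  (is_derive_mul is_derive_A1hat fdf)) is_derive_A0hat.
have h0 : is_derive x v (fun y => A2hat a1 a2 a3 y * f y ^+ 2
    + A1hat a1 a2 a3 y * f y + A0hat a1 a2 a3 y) 0.
  refine (near_eq_is_derive _ (is_derive_cst (0 : K) x v)).
  by near=> y; apply/esym/root_hat_poly; near: y.
rewrite -(@derive_val _ _ _ _ _ _ _ h0) (@derive_val _ _ _ _ _ _ _ h).
by ring.
Unshelve. all: by end_near. Qed.

(** Quotient rule for - V(f) / phi(f). The multiples of [df] are kept together because they cancel
    in the wedge with the differential of [f]. *)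
Lemma is_derive_phat : phi a1 a2 a3 (f x) != 0 ->
  is_derive x v (phat a1 a2 a3 f)
    (- (dV1 x v * f x + dV0 x v) / phi a1 a2 a3 (f x)
     + ((V1 x * f x + V0 x) * dphi (f x) / phi a1 a2 a3 (f x) ^+ 2
        - V1 x / phi a1 a2 a3 (f x)) * df).
Proof.
move=> phi0.
apply: (near_eq_is_derive (f := fun y =>
    - ((V1 y * f y + V0 y) * (phi a1 a2 a3 (f y))^-1))).
  near=> y => /=.
  have yu : u1 y - u2 y != 0 by near: y.
  have yu' : u2 y - u1 y != 0 by rewrite -opprB oppr_eq0.
  rewrite /phat -/(phi a1 a2 a3 (f y)) div1r.
  rewrite /V1 /V0 /slope /icept /val1 /val2.
  (* With the inverse generalized, the identity needs only that u_1 and u_2 differ at [y]. *)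
  by move: (phi _ _ _ (f y))^-1 => g; field; rewrite yu yu'.
have [d1 d0 _ _] := is_derive_VH v (nbhs_singleton xu).
refine (is_derive_eq (is_deriveN (is_derive_mul
  (is_deriveD (is_derive_mul d1 fdf) d0)
  (is_derive_inv (f := fun y => phi a1 a2 a3 (f y)) phi0
     (is_derive_phi fdf)))) _).
by rewrite !fctE; field.
Unshelve. all: by end_near. Qed.

End HatPolynomial.

(** * The wedge of dV and dA at a root of A *)

Definition omega v w : K :=
  (p1 v * u1 w - p1 w * u1 v) + (p2 v * u2 w - p2 w * u2 v).

(* With R = (z - u_1) (z - u_2) and T = (z - u_2) dp_1 ^ du_1
   + (z - u_1) dp_2 ^ du_2, the factorization yields
   dV ^ dA = phi * S - A * Y for the polynomials S = (dV ^ dH + A T) / R and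
   Y = (phi T + dV ^ dR) / R in z.  These divisions are exact, so that a root
   [z] of A is allowed to coincide with [u1 x] or [u2 x]. *)
Lemma wedge_V_Ahat x v w : u1 x - u2 x != 0 ->
  exists S0 : K, forall z : K, root (hat_poly a1 a2 a3 x) z ->
  (dV1 x v * z + dV0 x v) * (dA2 x w * z ^+ 2 + dA1 x w * z + dA0 x w)
  - (dV1 x w * z + dV0 x w) * (dA2 x v * z ^+ 2 + dA1 x v * z + dA0 x v)
  = phi a1 a2 a3 z * (A2hat a1 a2 a3 x * omega v w * z + S0).
Proof.
move=> xu.
(* The polynomial T is [omega v w * z + T0]. The witness below is the constant term of S, obtained
   from the two leading coefficients of the cubic dV ^ dH + A T on division by R. *)
pose T0 : K := - u2 x * (p1 v * u1 w - p1 w * u1 v)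
  - u1 x * (p2 v * u2 w - p2 w * u2 v).
exists (dV1 x v * dH1 x w - dV1 x w * dH1 x v + A2hat a1 a2 a3 x * T0
  + (A1hat a1 a2 a3 x + (u1 x + u2 x) * A2hat a1 a2 a3 x) * omega v w).
move=> z /root_hat_poly rootz.
(* The lower coefficients of the quotient Y, whose leading one is [- 4 * omega v w]. *)
pose Y1 : K := - 4 * T0 + 4 * (s1 - u1 x - u2 x) * omega v w.
pose Y0 : K := 4 * s1 * T0 - 4 * s2 * omega v w
  - (dV1 x v * (u1 w + u2 w) - dV1 x w * (u1 v + u2 v))
  + (u1 x + u2 x) * Y1 + 4 * u1 x * u2 x * omega v w.
(* Writing 0 as A(z) restores the term A Y; what remains is an identity for arbitrary z. *)
rewrite -[RHS]subr0 -(mul0r (- 4 * omega v w * z ^+ 2 + Y1 * z + Y0)).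
rewrite -[in X in _ = _ - X * _]rootz /Y0 /Y1 /T0 /omega.
rewrite A2hatE// A1hatE// A0hatE//.
rewrite /dA0 /dA1 /dA2 /V1 /V0 /H1 /H0 /dV1 /dV0 /dH1 /dH0.
rewrite /slope /icept /dslope /dicept /val1 /val2 /ham1 /ham2.
rewrite /dval1 /dval2 /dham1 /dham2 /dphi /phi /s1 /s2.
by field.
Qed.

Lemma ord2_case (i : 'I_2) : (i == 0) || (i == 1).
Proof. by case: i => [[|[|]]]. Qed.

(** * Invariance of the canonical 2-form *)

Section HatTransformation.
Variables (U : set (phase K)) (uhat : 'I_2 -> phase K -> K) (x : phase K).
Hypotheses (hU : open U) (Ux : U x).
Hypothesis huhat : forall k, differentiable (uhat k) x.
Hypothesis huhat_root : forall (k : 'I_2) (x : phase K), U x ->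
  root (hat_poly a1 a2 a3 x) (uhat k x).
Hypothesis hu : forall x : phase K, U x -> u1 x != u2 x.
Hypothesis hA2 : A2hat a1 a2 a3 x != 0.
Hypothesis huhat_neq : uhat 0 x != uhat 1 x.
Hypothesis huhat_gen : forall k, uhat k x \notin [:: 0; a1; a2; a3].

Lemma hat_symplectic v w :
  \sum_(k < 2) ('D_v (phat a1 a2 a3 (uhat k)) x * 'D_w (uhat k) x
              - 'D_w (phat a1 a2 a3 (uhat k)) x * 'D_v (uhat k) x)
  = omega v w.
Proof.
have nU : \forall y \near x, U y by exact: open_nbhs_nbhs.
have xu : \forall y \near x, u1 y - u2 y != 0.
  by apply: filterS nU => y /hu; rewrite subr_eq0.
have [S0 S0E] := wedge_V_Ahat v w (nbhs_singleton xu).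
have rt k := huhat_root k Ux.
have A20 := hA2; set A2 := A2hat a1 a2 a3 x in A20 S0E *.
(* Vieta's formula: subtract the two root equations and cancel the difference of the roots. *)
have A1E : A1hat a1 a2 a3 x = - A2 * (uhat 0 x + uhat 1 x).
  have := root_hat_poly (rt 0); have := root_hat_poly (rt 1).
  rewrite -/A2 => r1 r0.
  have d0 : uhat 0 x - uhat 1 x != 0 by rewrite subr_eq0.
  apply: (mulfI d0); apply/eqP; rewrite -subr_eq0; apply/eqP.
  by rewrite -[RHS](subrr 0) -{1}r0 -r1; ring.
(* Here [b] is A'(uhat_k). *)
have term k (b := 2 * A2 * uhat k x + A1hat a1 a2 a3 x) : b != 0 ->
    'D_v (phat a1 a2 a3 (uhat k)) x * 'D_w (uhat k) x
    - 'D_w (phat a1 a2 a3 (uhat k)) x * 'D_v (uhat k) x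
    = (A2 * omega v w * uhat k x + S0) / b.
  move=> b0.
  have phi0 : phi a1 a2 a3 (uhat k x) != 0.
    have := huhat_gen k; rewrite !inE !negb_or => /and4P[_ n1 n2 n3].
    by rewrite /phi !mulf_neq0 ?pnatr_eq0// subr_eq0 eq_sym.
  have nr : \forall y \near x, root (hat_poly a1 a2 a3 y) (uhat k y).
    by apply: filterS nU => y; exact: huhat_root.
  have du t : is_derive x t (uhat k) ('D_t (uhat k) x).
    exact/derivableP/diff_derivable.
  have dp t := @derive_val _ _ _ _ _ _ _ (is_derive_phat xu (du t) phi0).
  have dA t : dA2 x t * uhat k x ^+ 2 + dA1 x t * uhat k x + dA0 x t
      = - (b * 'D_t (uhat k) x).
    by apply/eqP; rewrite -addr_eq0 (is_derive_root xu (du t) nr).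
  have := S0E _ (rt k); rewrite !dA !dp => E.
  apply: (mulIf b0); rewrite divfK//; apply: (mulfI phi0); rewrite -E.
  by field.
(* The two values of A' are opposite, so the [S0] terms cancel in the sum and the remaining ones
   give omega. *)
have [b0 b1] : 2 * A2 * uhat 0 x + A1hat a1 a2 a3 x = A2 * (uhat 0 x - uhat 1 x)
    /\ 2 * A2 * uhat 1 x + A1hat a1 a2 a3 x = - (A2 * (uhat 0 x - uhat 1 x)).
  by rewrite A1E; split; ring.
have d0 : uhat 0 x - uhat 1 x != 0 by rewrite subr_eq0.
rewrite big_ord_recl big_ord1 (_ : lift _ _ = 1); last exact: val_inj.
rewrite !term ?b0 ?b1 ?oppr_eq0 ?mulf_neq0//.
by field; rewrite d0 A20.
Qed.

End HatTransformation.

End Canonical.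

Theorem proposition4 (K : numFieldType) (a1 a2 a3 : K)
  (ha12 : a1 != a2) (ha13 : a1 != a3) (ha23 : a2 != a3)
  (U : set (phase K)) (hU : open U)
  (uhat : 'I_2 -> phase K -> K)
  (huhat_smooth : forall k : 'I_2, smooth_on U (uhat k))
  (huhat_root : forall (k : 'I_2) (x : phase K), U x ->
     root (hat_poly a1 a2 a3 x) (uhat k x))
  (hu : forall x : phase K, U x -> u1 x != u2 x)
  (hA2 : forall x : phase K, U x -> A2hat a1 a2 a3 x != 0)
  (huhat_neq : forall x : phase K, U x -> uhat 0 x != uhat 1 x)
  (huhat_gen : forall (k : 'I_2) (x : phase K), U x ->
     uhat k x \notin [:: 0; a1; a2; a3]) :
  forall x : phase K, U x ->
    [/\ forall i j : 'I_2,
          bracket (uhat i) (phat a1 a2 a3 (uhat j)) x = (i == j)%:R,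
        bracket (uhat 0) (uhat 1) x = 0
      & bracket (phat a1 a2 a3 (uhat 0)) (phat a1 a2 a3 (uhat 1)) x = 0].
Proof.
move=> x Ux.
have sympl v w : \sum_(k < 2)
    ('D_v (phat a1 a2 a3 (uhat k)) x * 'D_w (uhat k) x
     - 'D_w (phat a1 a2 a3 (uhat k)) x * 'D_v (uhat k) x) = omega v w.
  exact: (hat_symplectic hU Ux (fun k => huhat_smooth k [::] x Ux) huhat_root
    hu (hA2 x Ux) (huhat_neq x Ux) (fun k => huhat_gen k x Ux)).
pose ph k := phat a1 a2 a3 (uhat k).
pose eu i : phase K := (delta_mx 0 i, 0).
pose ep i : phase K := (0, delta_mx 0 i).
have omega_eu i w : omega w (eu i) = w.2 0 i.
  rewrite /omega /u1 /u2 /p1 /p2 /= !mxE !eqxx /=.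
  by case/orP: (ord2_case i) => /eqP ->; rewrite /=; ring.
have omega_ep i w : omega w (ep i) = - w.1 0 i.
  rewrite /omega /u1 /u2 /p1 /p2 /= !mxE !eqxx /=.
  by case/orP: (ord2_case i) => /eqP ->; rewrite /=; ring.
pose Du (F : 'I_2 -> phase K -> K) := \matrix_(k, i) d_u i (F k) x.
pose Dp (F : 'I_2 -> phase K -> K) := \matrix_(k, i) d_p i (F k) x.
(* Evaluating the invariant form on pairs of coordinate vectors yields the three matrix
   hypotheses. *)
have [||| QP QQ PP] := @symplectic_trmx K 2 (Du uhat) (Dp uhat) (Du ph) (Dp ph).
- apply/matrixP => i j.
  transitivity (omega (eu i) (eu j)); last by rewrite omega_eu !mxE.
  rewrite -sympl !mxE -sumrB; apply: eq_bigr => k _.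
  by rewrite !mxE [X in _ - X]mulrC.
- apply/matrixP => i j.
  transitivity (omega (ep i) (ep j)); last by rewrite omega_ep !mxE oppr0.
  rewrite -sympl !mxE -sumrB; apply: eq_bigr => k _.
  by rewrite !mxE [X in _ - X]mulrC.
- apply/matrixP => i j.
  transitivity (omega (ep i) (eu j)); last by rewrite omega_eu !mxE eqxx eq_sym.
  rewrite -sympl !mxE -sumrB; apply: eq_bigr => k _.
  by rewrite !mxE [X in _ - X]mulrC.
(* Brackets are entries of the products of Jacobian blocks in the transposed relations. *)
have brE F G i j :
    bracket (F i) (G j) x = (Du F *m (Dp G)^T - Dp F *m (Du G)^T) i j.
  by rewrite !mxE -sumrB; apply: eq_bigr => k _; rewrite !mxE.
split=> [i j||].
- by rewrite (brE uhat ph) QP mxE.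
- by rewrite brE QQ mxE.
- by rewrite (brE ph ph) PP mxE.
Qed.
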